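(* The inverse monoid $S=\mathrm{Inv}\langle a,b,c,d \mid bcb^{-1}ad^{-1}a^{-1}c^{-1}cd^{-1}d=1\rangle$ is an $E$-unitary inverse monoid without locally bounded group distortion. Indeed, every Schützenberger graph of $S$ embeds in the Cayley graph of the maximal group image $G$ with unbounded distortion; that is, for every $\mathcal{R}$-class $R$ of $S$ there is no function $\phi\colon[0,\infty)\to[0,\infty)$ such that $d_S(s,t)\le\phi(d_G(\sigma(s),\sigma(t)))$ for all $s,t\in R$, where $d_S$ and $d_G$ are the word metrics with respect to the generators $a,b,c,d$.
   Context: An inverse semigroup is a semigroup in which every $s$ has a unique $s^{-1}$ with $ss^{-1}s=s$ and $s^{-1}ss^{-1}=s^{-1}$; an inverse monoid is an inverse semigroup with identity. $\mathrm{Inv}\langle X\mid R\rangle$ is the quotient of the free inverse monoid on $X$ by the congruence generated by the relations $R$. Elements $s,t$ are $\mathcal{R}$-related iff $ss^{-1}=tt^{-1}$. The maximal group image $G=S/\sigma$ is the quotient by the least congruence $\sigma$ identifying all idempotents; $\sigma\colon S\to G$ also denotes the natural homomorphism. $S$ is $E$-unitary if $\sigma$ is injective on each $\mathcal{R}$-class. The Cayley graph of $S$ with respect to a generating set $X$ has vertex set $S$ and edges $s\xrightarrow{x}sx$ for $s\in S$, $x\in X\cup X^{-1}$; its strongly connected components are the Schützenberger graphs, and their vertex sets are exactly the $\mathcal{R}$-classes. The word metric $d_S$ is the extended metric (values in $[0,\infty]$) in which the distance between $\mathcal{R}$-related elements is the path distance in their Schützenberger graph and the distance between non-$\mathcal{R}$-related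 elements is $\infty$; $d_G$ is the usual word metric on the group $G$. $S$ has locally bounded group distortion if for every $\mathcal{R}$-class $R$ there is a function $\phi\colon[0,\infty)\to[0,\infty)$ with $d_S(s,t)\le\phi(d_G(\sigma(s),\sigma(t)))$ for all $s,t\in R$. (For finitely generated $S$ one may use word metrics in this definition.) *)

(* Defs.v *)
From HB Require Import structures.
From mathcomp Require Import all_boot all_order all_algebra.
From mathcomp Require Import all_classical all_reals ereal.

Set Implicit Arguments.
Unset Strict Implicit.
Unset Printing Implicit Defensive.

Local Open Scope classical_set_scope.
Local Open Scope group_scope.

(* Inverse monoids.  In a [starMonoidType] one already has x^-1^-1 = x, so the
   first axiom also gives s^-1 s s^-1 = s^-1: s^-1 is an inverse of s, and by
   the second axiom it is the only one. *)
HB.mixin Record StarMonoid_isInverseMonoid M of StarMonoid M := {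
  mulgVg_id : forall s : M, s * s^-1 * s = s;
  invg_unique : forall s t : M, s * t * s = s -> t * s * t = t -> t = s^-1
}.

#[short(type="inverseMonoidType")]
HB.structure Definition InverseMonoid :=
  { M of StarMonoid_isInverseMonoid M & StarMonoid M }.

(* Equational presentation of the same structure, stable under quotients. *)
HB.factory Record StarMonoid_isCommInverse M of StarMonoid M := {
  mulgVg_id : forall s : M, s * s^-1 * s = s;
  mulgV_comm : forall s t : M, s * s^-1 * (t * t^-1) = t * t^-1 * (s * s^-1)
}.

HB.builders Context M of StarMonoid_isCommInverse M.

Lemma idemV (e : M) : e * e = e -> e = e * e^-1.
Proof.
move=> ee.
have eK : e^-1 * e * e^-1 = e^-1 by have := mulgVg_id e^-1; rewrite invgK.
have e1 : e * e^-1 = e^-1.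
  have eVeV : e^-1 * e^-1 = e^-1 by rewrite -invgM ee.
  have h : e^-1 = e * e^-1 * (e^-1 * e).
    have := mulgV_comm e^-1 e; rewrite invgK => <-.
    by rewrite mulgA -(mulgA e^-1) ee eK.
  by rewrite h !mulgA ee.
by rewrite -{1}(invgK e) -{1}e1 invgM invgK.
Qed.

Lemma idem_comm (e f : M) : e * e = e -> f * f = f -> e * f = f * e.
Proof. by move=> /idemV -> /idemV ->; exact: mulgV_comm. Qed.

Lemma invg_unique (s t : M) : s * t * s = s -> t * s * t = t -> t = s^-1.
Proof.
move=> sts tst.
have svs := mulgVg_id s.
have vsv : s^-1 * s * s^-1 = s^-1 by have := mulgVg_id s^-1; rewrite invgK.
have i1 : s * t * (s * t) = s * t by rewrite mulgA sts.
have i2 : t * s * (t * s) = t * s by rewrite mulgA tst.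
have i3 : s * s^-1 * (s * s^-1) = s * s^-1 by rewrite mulgA svs.
have i4 : s^-1 * s * (s^-1 * s) = s^-1 * s by rewrite mulgA vsv.
have c1 := idem_comm i1 i3; have c2 := idem_comm i2 i4.
have e1 : s^-1 * s * t = t.
  by rewrite -{1}tst mulgA mulgA -(mulgA (s^-1 * s)) -c2
             -!mulgA (mulgA s s^-1) (mulgA (s * s^-1)) svs mulgA tst.
have e2 : s^-1 * s * t = s^-1.
  by rewrite -{1}vsv -!mulgA (mulgA s s^-1 (s * t)) -c1 -!mulgA (mulgA s t)
             (mulgA (s * t)) sts mulgA vsv.
by rewrite -e1 e2.
Qed.

HB.instance Definition _ :=
  StarMonoid_isInverseMonoid.Build M mulgVg_id invg_unique.

HB.end.

Lemma mulgV_comm (M : inverseMonoidType) (s t : M) :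
  s * s^-1 * (t * t^-1) = t * t^-1 * (s * s^-1).
Proof.
suff clos (u v : M) : u * u = u -> v * v = v -> u * v * (u * v) = u * v.
  have idV (u : M) : u * u = u -> u^-1 = u.
    by move=> uu; symmetry; apply: invg_unique; rewrite uu.
  have idS (u : M) : u * u^-1 * (u * u^-1) = u * u^-1.
    by rewrite mulgA mulgVg_id.
  have := idV _ (clos _ _ (idS s) (idS t)).
  by rewrite invgM !invgM !invgK => ->.
move=> uu vv; set w := u * v.
have wVw : w^-1 * w * w^-1 = w^-1 by have := mulgVg_id w^-1; rewrite invgK.
have wwV := mulgVg_id w.
have e : v * w^-1 * u = w^-1.
  apply: invg_unique.
    rewrite -[RHS]wwV /w -!mulgA; congr (_ * _).
    by rewrite (mulgA v v) vv (mulgA u u) uu.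
  rewrite -{3}wVw /w -!mulgA.
  by rewrite (mulgA u u) uu (mulgA v v) vv.
have wVi : w^-1 * w^-1 = w^-1.
  by rewrite -{1 2}e -!mulgA (mulgA u v) -/w (mulgA w^-1 w) (mulgA (w^-1 * w)) wVw mulgA.
have <- : w^-1 = w.
  by rewrite -[RHS](invgK w); apply: invg_unique; rewrite wVi.
exact: wVi.
Qed.

Section Congruence.
Variable M : monoidType.

Definition congruence (c : M -> M -> Prop) : Prop :=
  [/\ forall s, c s s, forall s t, c s t -> c t s,
      forall s t u, c s t -> c t u -> c s u &
      forall s t u v, c s t -> c u v -> c (s * u) (t * v)].

Definition congruence_gen (r : M -> M -> Prop) (s t : M) : Prop :=
  forall c, congruence c -> (forall u v, r u v -> c u v) -> c s t.

Variable r : M -> M -> Prop.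

Lemma congruence_genP : congruence (congruence_gen r).
Proof.
split=> [s|s t h|s t u h1 h2|s t u v h1 h2] c cc rc; case: (cc) => c1 c2 c3 c4.
- exact: c1.
- by apply: c2; apply: h.
- by apply: (c3 _ t); [apply: h1|apply: h2].
- by apply: c4; [apply: h1|apply: h2].
Qed.

Lemma congruence_gen_sub s t : r s t -> congruence_gen r s t.
Proof. by move=> h c _; apply. Qed.

Definition congruence_rel : rel M := fun s t => `[< congruence_gen r s t >].

Fact congruence_rel_equiv : equiv_class_of congruence_rel.
Proof.
case: congruence_genP => c1 c2 c3 _; split=> [s|s t|t s u].
- exact/asboolP.
- by apply/asboolP/asboolP; apply: c2.
- by move=> /asboolP h1 /asboolP h2; apply/asboolP; apply: c3 h1 h2.
Qed.

Canonical congruence_equiv := EquivRelPack congruence_rel_equiv.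

Definition quo : Type := {eq_quot congruence_equiv}%qT.

HB.instance Definition _ := Choice.on quo.
HB.instance Definition _ := Quotient.on quo.

Lemma quoP (s t : M) : \pi_quo%qT s = \pi_quo%qT t <-> congruence_gen r s t.
Proof.
split=> [/eqmodP/asboolP //|h]; apply/eqmodP; exact/asboolP.
Qed.

Lemma repr_quo (s : M) : congruence_gen r (repr (\pi_quo%qT s)) s.
Proof. by apply/quoP; rewrite reprK. Qed.

Fact quo_key : unit. Proof. by []. Qed.

Definition quo_mul : quo -> quo -> quo :=
  locked_with quo_key (fun p q => \pi_quo%qT (repr p * repr q)).

Lemma quo_mulE (s t : M) :
  quo_mul (\pi_quo%qT s) (\pi_quo%qT t) = \pi_quo%qT (s * t).
Proof.
rewrite /quo_mul unlock.
apply/quoP; case: congruence_genP => _ _ _ c4.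
by apply: c4; exact: repr_quo.
Qed.

Fact quo_mulA : associative quo_mul.
Proof.
move=> p q u; move: (reprK p) (reprK q) (reprK u).
move: (repr p) (repr q) (repr u) => s t v <- <- <-.
by rewrite !quo_mulE mulgA.
Qed.

Fact quo_mul1 : left_id (\pi_quo%qT 1) quo_mul.
Proof. by move=> p; rewrite -(reprK p) quo_mulE mul1g. Qed.

Fact quo_1mul : right_id (\pi_quo%qT 1) quo_mul.
Proof. by move=> p; rewrite -(reprK p) quo_mulE mulg1. Qed.

HB.instance Definition _ := isMonoid.Build quo quo_mulA quo_mul1 quo_1mul.

Lemma quoM (s t : M) : \pi_quo%qT (s * t) = \pi_quo%qT s * \pi_quo%qT t.
Proof. by rewrite -quo_mulE. Qed.

Lemma quo1 : \pi_quo%qT 1 = 1.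
Proof. by []. Qed.

Definition quo_proj (s : M) : quo := \pi_quo%qT s.

End Congruence.

Arguments quo_proj {M} r s.

Lemma quo_ind (M : monoidType) (r : M -> M -> Prop) (P : quo r -> Prop) :
  (forall s, P (quo_proj r s)) -> forall p, P p.
Proof. by move=> h p; rewrite -(reprK p); apply: h. Qed.

Lemma quo_projM (M : monoidType) (r : M -> M -> Prop) (s t : M) :
  quo_proj r (s * t) = quo_proj r s * quo_proj r t.
Proof. exact: quoM. Qed.

Section StarQuotient.
Variables (M : starMonoidType) (r : M -> M -> Prop).
Hypothesis rV : forall s t, congruence_gen r s t -> congruence_gen r s^-1 t^-1.

Definition quo_inv : quo r -> quo r :=
  locked_with quo_key (fun p => quo_proj r (repr p)^-1).

Lemma quo_invE (s : M) : quo_inv (quo_proj r s) = quo_proj r s^-1.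
Proof. by rewrite /quo_inv unlock; apply/quoP; apply: rV; exact: repr_quo. Qed.

Lemma quo_invK : involutive quo_inv.
Proof. by elim/quo_ind => s; rewrite !quo_invE invgK. Qed.

Lemma quo_invM : {morph quo_inv : p q / p * q >-> q * p}.
Proof.
elim/quo_ind => s; elim/quo_ind => t.
by rewrite -quo_projM !quo_invE invgM quo_projM.
Qed.

End StarQuotient.

Section InverseQuotient.
Variables (M : inverseMonoidType) (r : M -> M -> Prop).

Lemma congruence_genV (s t : M) :
  congruence_gen r s t -> congruence_gen r s^-1 t^-1.
Proof.
move=> /quoP st; apply/quoP.
rewrite -/(quo_proj r s) -/(quo_proj r t) in st *.
rewrite -/(quo_proj r s^-1) -/(quo_proj r t^-1).
have V (u : M) : u^-1 * u * u^-1 = u^-1.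
  by have := mulgVg_id u^-1; rewrite invgK.
have c1 := congr1 (quo_proj r) (mulgV_comm s t).
have c2 := congr1 (quo_proj r) (mulgV_comm s^-1 t^-1).
have s1 := congr1 (quo_proj r) (mulgVg_id s).
have s2 := congr1 (quo_proj r) (V s).
have t1 := congr1 (quo_proj r) (mulgVg_id t).
have t2 := congr1 (quo_proj r) (V t).
rewrite !invgK !quo_projM -st in c1 c2 s1 s2 t1 t2.
move: (quo_proj r s) (quo_proj r s^-1) (quo_proj r t^-1) c1 c2 s1 s2 t1 t2.
move=> a p q c1 c2 s1 s2 t1 t2.
have -> : p = p * a * q.
  by rewrite -[LHS]s2 -{1}t1 -!mulgA (mulgA a q (a * p)) -c1
     -!mulgA (mulgA a p) (mulgA (a * p)) s1 (mulgA p a).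
rewrite -[RHS]t2 -{2}s1 -!mulgA (mulgA q a) (mulgA p a) (mulgA (q * a)) -c2.
by rewrite -!mulgA (mulgA a q) (mulgA (a * q)) t1.
Qed.

HB.instance Definition _ := hasInv.Build (quo r) (@quo_inv M r).
HB.instance Definition _ := Monoid_isStarMonoid.Build (quo r)
  (quo_invK congruence_genV) (quo_invM congruence_genV).

Lemma quo_projV (s : M) : quo_proj r s^-1 = (quo_proj r s)^-1.
Proof. by rewrite -(quo_invE congruence_genV). Qed.

Fact quo_mulVg_id (p : quo r) : p * p^-1 * p = p.
Proof.
by elim/quo_ind: p => s; rewrite -quo_projV -!quo_projM mulgVg_id.
Qed.

Fact quo_mulgV_comm (p q : quo r) :
  p * p^-1 * (q * q^-1) = q * q^-1 * (p * p^-1).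
Proof.
elim/quo_ind: p => s; elim/quo_ind: q => t.
by rewrite -!quo_projV -!quo_projM mulgV_comm.
Qed.

HB.instance Definition _ :=
  StarMonoid_isCommInverse.Build (quo r) quo_mulVg_id quo_mulgV_comm.

End InverseQuotient.

(* Words over X and formal inverses: (x, false) stands for x and (x, true) for
   x^-1. *)
Definition iword (X : Type) : Type := seq (X * bool).

Section Words.
Variable X : choiceType.

HB.instance Definition _ := Choice.copy (iword X) (seq (X * bool)).

Definition iword_inv (w : iword X) : iword X :=
  rev [seq (l.1, ~~ l.2) | l <- w].

Fact iword_invK : involutive iword_inv.
Proof.
move=> w; rewrite /iword_inv map_rev revK -map_comp map_id_in // => -[x b] _ /=.
by rewrite negbK.
Qed.

Fact iword_invM (u v : iword X) :
  iword_inv (u ++ v) = iword_inv v ++ iword_inv u.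
Proof. by rewrite /iword_inv map_cat rev_cat. Qed.

HB.instance Definition _ := isStarMonoid.Build (iword X)
  (@catA _) (@cat0s _) iword_invK iword_invM.

(* The Wagner congruence is generated by these pairs. *)
Variant wagner : iword X -> iword X -> Prop :=
| wagner_reg u : wagner (u * u^-1 * u) u
| wagner_comm u v : wagner (u * u^-1 * (v * v^-1)) (v * v^-1 * (u * u^-1)).

Lemma wagnerV (s t : iword X) :
  congruence_gen wagner s t -> congruence_gen wagner s^-1 t^-1.
Proof.
case: (congruence_genP wagner) => c1 c2 c3 c4 /(_ (fun s t =>
  congruence_gen wagner s^-1 t^-1)); apply.
  split=> [?|? ?|? ? ?|? ? ? ? h1 h2]; [exact: c1|exact: c2|exact: c3|].
  by rewrite !invgM; apply: c4.
move=> _ _ [u|u v]; apply: congruence_gen_sub; rewrite !invgM !invgK.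
  by rewrite mulgA; have := wagner_reg u^-1; rewrite invgK.
exact: wagner_comm.
Qed.

Definition FIM : Type := quo wagner.

HB.instance Definition _ := Monoid.on FIM.
HB.instance Definition _ := hasInv.Build FIM (@quo_inv _ wagner).
HB.instance Definition _ := Monoid_isStarMonoid.Build FIM
  (quo_invK wagnerV) (quo_invM wagnerV).

Fact FIM_projV (s : iword X) :
  quo_proj wagner s^-1 = (quo_proj wagner s : FIM)^-1.
Proof. by rewrite -(quo_invE wagnerV). Qed.

Fact FIM_mulVg_id (p : FIM) : p * p^-1 * p = p.
Proof.
elim/quo_ind: p => s; rewrite -FIM_projV -!quo_projM.
by apply/quoP; apply: congruence_gen_sub; exact: wagner_reg.
Qed.

Fact FIM_mulgV_comm (p q : FIM) :
  p * p^-1 * (q * q^-1) = q * q^-1 * (p * p^-1).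
Proof.
elim/quo_ind: p => s; elim/quo_ind: q => t; rewrite -!FIM_projV -!quo_projM.
by apply/quoP; apply: congruence_gen_sub; exact: wagner_comm.
Qed.

HB.instance Definition _ :=
  StarMonoid_isCommInverse.Build FIM FIM_mulVg_id FIM_mulgV_comm.

Definition fim_gen (x : X) : FIM := quo_proj wagner [:: (x, false)].

End Words.

(* Inv<X | rels>; [rels u v] means that u = v is one of the relations. *)
Definition Inv (X : choiceType) (rels : FIM X -> FIM X -> Prop) : Type :=
  quo rels.

HB.instance Definition _ (X : choiceType) (rels : FIM X -> FIM X -> Prop) :=
  InverseMonoid.on (Inv rels).

Definition inv_gen (X : choiceType) (rels : FIM X -> FIM X -> Prop) (x : X) :
  Inv rels := quo_proj rels (fim_gen x).

Definition both_idempotent (M : monoidType) (e f : M) : Prop :=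
  e * e = e /\ f * f = f.

Section MaximalGroupImage.
Variable S : inverseMonoidType.

Definition max_group_image : Type := quo (@both_idempotent S).

HB.instance Definition _ := InverseMonoid.on max_group_image.

Definition sigma (s : S) : max_group_image := quo_proj (@both_idempotent S) s.

Fact max_group_image_mulVg :
  left_inverse (1 : max_group_image) (fun p => p^-1) (fun p q => p * q).
Proof.
apply: quo_ind => s /=; rewrite -(quo_projV _ s) -quo_projM.
apply/quoP; apply: congruence_gen_sub; split; last exact: mulg1.
by rewrite mulgA -{2}(invgK s) mulgVg_id.
Qed.

HB.instance Definition _ :=
  StarMonoid_isGroup.Build max_group_image max_group_image_mulVg.

End MaximalGroupImage.

Definition Rrelated (S : starMonoidType) (s t : S) : Prop :=
  s * s^-1 = t * t^-1.

Definition Rclass (S : starMonoidType) (s : S) : set S :=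
  [set t | Rrelated s t].

Definition is_Rclass (S : starMonoidType) (C : set S) : Prop :=
  exists s, C = Rclass s.

Definition E_unitary (S : inverseMonoidType) : Prop :=
  forall C : set S, is_Rclass C -> set_inj C (@sigma S).

Section CayleyGraph.
Variables (R : realType) (X : Type) (M : starMonoidType) (gen : X -> M).

Definition letter_val (l : X * bool) : M :=
  if l.2 then (gen l.1)^-1 else gen l.1.

Definition cayley_edge (s : M) (l : X * bool) (t : M) : Prop :=
  t = s * letter_val l.

(* Directed paths from s to t, labelled by a word, in the full subgraph of the
   Cayley graph on the vertex set V. *)
Fixpoint cayley_path (V : set M) (s : M) (w : iword X) (t : M) : Prop :=
  if w is l :: w' then
    V s /\ exists2 u, cayley_edge s l u & cayley_path V u w' t
  else V s /\ s = t.

Definition path_dist (V : set M) (s t : M) : \bar R :=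
  ereal_inf [set ((size w)%:R)%:E | w in [set w | cayley_path V s w t]].

(* In a group the only R-class is the whole group, hence this is also the usual
   word metric there. *)
Definition word_dist (s t : M) : \bar R :=
  if `[< Rrelated s t >] then path_dist (Rclass s) s t else +oo%E.

End CayleyGraph.

Section Distortion.
Variables (R : realType) (X : Type) (S : inverseMonoidType) (gen : X -> S).

(* The distance in the group is finite as soon as gen generates S. *)
Definition bounded_distortion_on (C : set S) : Prop :=
  exists phi : R -> R,
    (forall x, (0 <= x)%R -> (0 <= phi x)%R) /\
    forall s t, C s -> C t ->
      (word_dist R gen s t <=
         (phi (fine (word_dist R (@sigma S \o gen) (sigma s) (sigma t))))%:E)%E.

Definition locally_bounded_group_distortion : Prop :=
  forall C : set S, is_Rclass C -> bounded_distortion_on C.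

(* The Schutzenberger graph on the R-class C embeds, as a labelled graph, in
   the Cayley graph of the maximal group image via sigma. *)
Definition schutzenberger_embeds (C : set S) : Prop :=
  set_inj C (@sigma S) /\
  forall s t l, C s -> C t -> cayley_edge gen s l t ->
    cayley_edge (@sigma S \o gen) (sigma s) l (sigma t).

End Distortion.

Variant letter : Set := La | Lb | Lc | Ld.

HB.instance Definition _ := gen_eqMixin letter.
HB.instance Definition _ := gen_choiceMixin letter.

Definition relator : FIM letter :=
  let a := fim_gen La in let b := fim_gen Lb in
  let c := fim_gen Lc in let d := fim_gen Ld in
  b * c * b^-1 * a * d^-1 * a^-1 * c^-1 * c * d^-1 * d.

Definition S_rels (u v : FIM letter) : Prop := u = relator /\ v = 1.

Definition S_monoid : inverseMonoidType := Inv S_rels.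

Definition S_gen : letter -> S_monoid := @inv_gen letter S_rels.

(* Main.v *)
Require Import Defs.
From mathcomp Require Import all_boot all_order all_algebra.
From mathcomp Require Import all_classical all_reals ereal.
From mathcomp Require Import zify.

(* Put p = b c b^-1.  The relation says exactly that a and b are right
   invertible, that c and d are left invertible, and that p = a d a^-1 is right
   invertible.  So G is free on a, b, p, with c = b^-1 p b and d = a^-1 p a.

   E-unitarity: S is not F-inverse, since a^-1 b lies strictly below
   d^N a^-1 b c^-N, and these elements increase with N.  But for each N a
   reduced word g in a, b, p can be lifted to an element of S that is as large
   as possible up to this choice of N; by induction on the length, every word w
   lies below the lift of its value in G as soon as N is large enough.  Two
   R-related elements with the same image in G then lie below a common element,
   hence are equal.

   Distortion: s b c^-n = s p^-n b and s a d^-n = s p^-n a in G, so these two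
   elements of the R-class of s stay at constant distance in G.  Let a, b, p act
   on a set and remove from it the points s p^-k for k large; the rest is stable
   under the right units a, b, p, c^-1, d^-1, so S acts on it by partial
   bijections.  Every path from s b c^-n to s a d^-n in the R-class then has to
   climb back along p, so its length grows linearly with n. *)

Set Implicit Arguments.
Unset Strict Implicit.
Unset Printing Implicit Defensive.

Import Order.TTheory GRing.Theory Num.Theory.
Local Open Scope group_scope.

(** * The natural partial order of an inverse monoid *)

Section NaturalOrder.
Variable M : inverseMonoidType.
Implicit Types s t u v e : M.

Lemma idem_mulgV s : s * s^-1 * (s * s^-1) = s * s^-1.
Proof. by rewrite mulgA mulgVg_id. Qed.

Lemma idemgV e : e * e = e -> e^-1 = e.
Proof. by move=> ee; symmetry; apply: invg_unique; rewrite ee. Qed.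

Lemma idem_comm e f : e * e = e -> f * f = f -> e * f = f * e.
Proof.
by move=> ee ff; have := mulgV_comm e f; rewrite (idemgV ee) (idemgV ff) ee ff.
Qed.

Lemma idemM e f : e * e = e -> f * f = f -> e * f * (e * f) = e * f.
Proof.
move=> ee ff.
by rewrite mulgA -(mulgA e f) (idem_comm ff ee) mulgA ee -mulgA ff.
Qed.

Lemma idem_conj s e : e * e = e -> s * e = s * e * s^-1 * s.
Proof.
move=> ee; rewrite -{1}(mulgVg_id s) -!mulgA; congr (_ * _).
rewrite !mulgA -(idem_comm ee) ?mulgA //.
by have := idem_mulgV s^-1; rewrite invgK !mulgA.
Qed.

Lemma idem_conjV s e :
  e * e = e -> s * e * s^-1 * (s * e * s^-1) = s * e * s^-1.
Proof.
by move=> ee; rewrite !mulgA -idem_conj // -(mulgA s) ee.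
Qed.

Definition nat_le s t : Prop := exists2 e, e * e = e & s = e * t.

Lemma nat_le_refl s : nat_le s s.
Proof. by exists 1; rewrite mul1g. Qed.

Lemma nat_le_trans t s u : nat_le s t -> nat_le t u -> nat_le s u.
Proof.
move=> [e ee ->] [f ff ->]; exists (e * f); last by rewrite mulgA.
exact: idemM.
Qed.

Lemma nat_leM s t u v : nat_le s t -> nat_le u v -> nat_le (s * u) (t * v).
Proof.
move=> [e ee ->] [f ff ->]; exists (e * (t * f * t^-1)).
  by apply: idemM => //; apply: idem_conjV.
by rewrite -!mulgA (mulgA t f v) (idem_conj t ff) !mulgA.
Qed.

Lemma nat_leMl s u v : nat_le u v -> nat_le (s * u) (s * v).
Proof. exact/nat_leM/nat_le_refl. Qed.

Lemma mulg_le1 s t : nat_le s 1 -> nat_le (t * s) t.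
Proof. by move=> /(nat_leMl t); rewrite mulg1. Qed.

Lemma nat_leMr s u v : nat_le u v -> nat_le (u * s) (v * s).
Proof. by move=> /nat_leM; apply; apply: nat_le_refl. Qed.

Lemma nat_leV s t : nat_le s t -> nat_le s^-1 t^-1.
Proof.
move=> [e ee ->]; exists (t^-1 * e * t).
  by have := idem_conjV t^-1 ee; rewrite invgK.
by rewrite invgM (idemgV ee) {1}(idem_conj t^-1 ee) invgK.
Qed.

Lemma nat_le_mulgV s : nat_le (s * s^-1) 1.
Proof. by exists (s * s^-1); rewrite ?mulg1 ?idem_mulgV. Qed.

Lemma nat_le_mulVg s : nat_le (s^-1 * s) 1.
Proof. by have := nat_le_mulgV s^-1; rewrite invgK. Qed.

Lemma nat_leE s t : nat_le s t -> s = s * s^-1 * t.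
Proof.
move=> [e ee ->]; rewrite invgM (idemgV ee) -!mulgA (mulgA t t^-1).
by rewrite (mulgA (t * t^-1)) (idem_comm (idem_mulgV t) ee) -!mulgA (mulgA t)
           mulgVg_id mulgA ee.
Qed.

End NaturalOrder.

(** * Integer powers, which multiply only up to the natural order *)

Section IntegerPowers.
Variable M : inverseMonoidType.
Implicit Types (s : M) (j k : int).

Definition zexpg s k : M :=
  match k with Posz n => s ^+ n | Negz n => s^-1 ^+ n.+1 end.

Lemma zexpg_opp s k : zexpg s (- k)%R = zexpg s^-1 k.
Proof. by case: k => [[|n]|n] //; rewrite NegzE opprK /= invgK. Qed.

Lemma zexpgV s k : (zexpg s k)^-1 = zexpg s (- k)%R.
Proof. by rewrite zexpg_opp; case: k => n /=; rewrite -expVgn ?invgK. Qed.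

Lemma zexpg_mulr s k : nat_le (zexpg s k * s) (zexpg s (k + 1)%R).
Proof.
case: k => [n|n]; first by rewrite /= addn1 expgSr; apply: nat_le_refl.
have -> : (Negz n + 1 = - Posz n)%R by rewrite NegzE -addn1 PoszD opprD addrNK.
rewrite zexpg_opp /= expgSr -mulgA.
rewrite -[X in nat_le _ X]mulg1; apply: nat_leMl.
by have := nat_le_mulVg s.
Qed.

Lemma zexpg_mulrV s k : nat_le (zexpg s k * s^-1) (zexpg s (k - 1)%R).
Proof.
by have := zexpg_mulr s^-1 (- k)%R; rewrite -!zexpg_opp opprK opprD opprK.
Qed.

Lemma zexpgD s j k : nat_le (zexpg s j * zexpg s k) (zexpg s (j + k)%R).
Proof.
elim: k => [|n IH|n IH].
- by rewrite addr0 mulg1; apply: nat_le_refl.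
- rewrite -addn1 PoszD addrA [zexpg s (Posz n + 1)%R]/= addn1 expgSr mulgA.
  exact: nat_le_trans (nat_leMr _ IH) (zexpg_mulr _ _).
- rewrite -addn1 PoszD opprD addrA.
  suff -> : zexpg s (- Posz n - 1)%R = zexpg s (- Posz n)%R * s^-1.
    by rewrite mulgA; apply: nat_le_trans (nat_leMr _ IH) (zexpg_mulrV _ _).
  by rewrite -opprD !zexpg_opp -PoszD addn1 /= expgSr.
Qed.

End IntegerPowers.

(* A stack and an exponent encode an element of the free group on two letters
   (the booleans) and p, with rightmost syllable first: in [(st, k)], p^k comes
   last, and [(k', x, e)] stands for p^k' x if e is true, p^k' x^-1 if not. *)
Definition stack := seq (int * bool * bool).

Definition cancels (x e : bool) (n : stack * int) : bool :=
  if n.1 is (_, y, e') :: _ then [&& n.2 == 0%R, y == x & e' == ~~ e]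
  else false.

Definition push (x e : bool) (n : stack * int) : stack * int :=
  if cancels x e n then (behead n.1, (head (n.2, x, e) n.1).1.1)
  else ((n.2, x, e) :: n.1, 0%R).

Definition shift (j : int) (n : stack * int) : stack * int :=
  (n.1, (n.2 + j)%R).

(** * Lifting normal forms to the monoid *)

Section NormalForms.
Variables (M : inverseMonoidType) (X Q : bool -> M) (p : M).
Hypothesis XV : forall x, X x * (X x)^-1 = 1.
Hypothesis pE : forall x, p = X x * Q x * (X x)^-1.
Hypothesis pV : p * p^-1 = 1.

(** Right units are maximal in the natural order, and [p * X x] is one, so the inequality [le] is an
    equality. *)
Lemma mul_pX x : p * X x = X x * Q x.
Proof.
have le : nat_le (p * X x) (X x * Q x).
  by rewrite {1}(pE x) -mulgA; apply/mulg_le1/nat_le_mulVg.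
by rewrite {1}(nat_leE le) invgM !mulgA -(mulgA p) XV mulg1 pV mul1g.
Qed.

Lemma mul_X_zexpQ_XV x k : X x * zexpg (Q x) k * (X x)^-1 = zexpg p k.
Proof.
have pos n : X x * Q x ^+ n * (X x)^-1 = p ^+ n.
  elim: n => [|n IH]; first by rewrite mulg1 XV.
  by rewrite !expgS !mulgA -mul_pX -!mulgA (mulgA (X x)) IH.
case: k => n; first exact: pos.
by rewrite /= !expVgn -(pos n.+1) !invgM invgK mulgA.
Qed.

Lemma zexp_pX x k : nat_le (zexpg p k * X x) (X x * zexpg (Q x) k).
Proof.
rewrite -(mul_X_zexpQ_XV x) -mulgA; exact/mulg_le1/nat_le_mulVg.
Qed.

Lemma XV_zexp_p x k :
  nat_le ((X x)^-1 * zexpg p k) (zexpg (Q x) k * (X x)^-1).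
Proof.
have := nat_leV (zexp_pX x (- k)%R).
by rewrite !invgM !zexpgV !opprK.
Qed.

(** Insert p p^-1 = 1 between y^-1 and x, then move p to the left and p^-1 to the right. Iteration
    gives the family increasing with N. *)
Lemma XV_X_shift x y :
  nat_le ((X y)^-1 * X x) (Q y * (X y)^-1 * X x * (Q x)^-1).
Proof.
rewrite -{1}(mul1g (X x)) -pV -!mulgA (mulgA (X y)^-1) (mulgA (Q y)).
by apply: nat_leM; [have := XV_zexp_p y 1%:Z|have := zexp_pX x (-1)%R].
Qed.

Lemma XV_X_shiftn x y k N : (k <= Posz N)%R ->
  nat_le (zexpg (Q y) k * (X y)^-1 * X x)
         (zexpg (Q y) N * (X y)^-1 * X x * zexpg (Q x) (k - Posz N)%R).
Proof.
move=> kN; have -> : k = (Posz N - Posz `|(Posz N - k)%R|%N)%R.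
  by rewrite gez0_abs ?subr_ge0 // opprB addrCA subrr addr0.
move: `|_|%N => {k kN} n.
have -> : (Posz N - Posz n - Posz N = - Posz n)%R by rewrite addrAC subrr add0r.
elim: n => [|n IH]; first by rewrite subr0 mulg1; apply: nat_le_refl.
have -> : zexpg (Q x) (- Posz n.+1)%R = zexpg (Q x) (- Posz n)%R * (Q x)^-1.
  by rewrite !zexpg_opp /= expgSr.
rewrite mulgA; apply: nat_le_trans (nat_leMr _ IH); rewrite -!mulgA.
apply: nat_le_trans (nat_leMl _ (XV_X_shift x y)) _; rewrite !mulgA.
do 3 apply: nat_leMr; have := zexpg_mulr (Q y) (Posz N - Posz n.+1)%R.
by rewrite -addn1 PoszD opprD addrA addrNK.
Qed.

Variable N : nat.

(* [val_end st k] lifts the word of [(st, k)], and [val_next st k x] lifts this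
   word followed by the letter x.  Among the available liftings of a power of p
   between two letters, the largest one is taken; between y^-1 and x with
   y <> x there is no largest one, and N selects a term of the increasing
   family (Q y)^N y^-1 x (Q x)^(k - N). *)
Fixpoint val_end (st : stack) (k : int) : M :=
  match st with
  | [::] => zexpg p k
  | (k', x, true) :: st' => val_next st' k' x * zexpg p k
  | (k', x, false) :: st' => val_end st' k' * zexpg (Q x) k * (X x)^-1
  end
with val_next (st : stack) (k : int) (x : bool) : M :=
  match st with
  | [::] => X x * zexpg (Q x) k
  | (k', y, true) :: st' => val_next st' k' y * X x * zexpg (Q x) k
  | (k', y, false) :: st' =>
      if y == x then val_end st' k' * zexpg (Q x) k
      else val_end st' k' * zexpg (Q y) N * (X y)^-1 * X x
             * zexpg (Q x) (k - Posz N)%R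
  end.

Definition val_nf (n : stack * int) : M := val_end n.1 n.2.

(** The bound on k enters when x follows y^-1 p^k with y <> x: the exponent of [Q y] is then raised
    from k to N. *)
Lemma val_end_mulX st (k : int) x : (k <= Posz N)%R ->
  nat_le (val_end st k * X x) (val_nf (push x true (st, k))).
Proof.
move=> kN; rewrite /push /cancels; case: ifPn => [|_].
  case: st => [|[[k' y] []] st] //=; rewrite ?andbF //.
  rewrite andbT => /andP[/eqP -> /eqP ->]; rewrite mulg1 -mulgA.
  exact/mulg_le1/nat_le_mulVg.
rewrite /val_nf /= mulg1; case: st => [|[[k' y] []] st] /=.
- exact: zexp_pX.
- by rewrite -!mulgA; apply/nat_leMl/zexp_pX.
- case: eqP => [->|_].
    by rewrite -!mulgA mulgA; apply/mulg_le1/nat_le_mulVg.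
  by rewrite -!mulgA; apply: nat_leMl; rewrite !mulgA; apply: XV_X_shiftn.
Qed.

Lemma val_next_mulXV st k x :
  nat_le (val_next st k x * (X x)^-1) (val_end st k).
Proof.
case: st => [|[[k' y] []] st] /=.
- by rewrite mul_X_zexpQ_XV; apply: nat_le_refl.
- by rewrite -!mulgA (mulgA (X x)) mul_X_zexpQ_XV; apply: nat_le_refl.
- case: eqP => [->|_]; first exact: nat_le_refl.
  (* p^(k - N) moves back across y^-1 and merges with (Q y)^N, so the choice of N disappears. *)
  rewrite -!mulgA (mulgA (X x)) mul_X_zexpQ_XV; apply: nat_leMl.
  apply: nat_le_trans (nat_leMl _ (XV_zexp_p _ _)) _; rewrite mulgA.
  apply: nat_leMr; have := zexpgD (Q y) N (k - Posz N)%R.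
  by rewrite addrCA subrr addr0.
Qed.

Lemma val_end_mulXV st k x :
  nat_le (val_end st k * (X x)^-1) (val_nf (push x false (st, k))).
Proof.
rewrite /push /cancels; case: ifPn => [|_].
  case: st => [|[[k' y] []] st] //=; rewrite ?andbF //.
  rewrite andbT => /andP[/eqP -> /eqP ->]; rewrite mulg1.
  exact: val_next_mulXV.
by rewrite /val_nf /= mulg1; apply: nat_le_refl.
Qed.

Lemma val_next_zexpQ st k j x :
  nat_le (val_next st k x * zexpg (Q x) j) (val_nf (push x true (st, k + j)%R)).
Proof.
rewrite /push /cancels; case: ifPn => [|_].
  case: st => [|[[k' y] []] st] //=; rewrite ?andbF //.
  rewrite andbT => /andP[/eqP kj /eqP ->]; rewrite eqxx -mulgA.
  by apply: mulg_le1; have := zexpgD (Q x) k j; rewrite kj.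
rewrite /val_nf /= mulg1; case: st => [|[[k' y] []] st] /=.
- by rewrite -mulgA; apply/nat_leMl/zexpgD.
- by rewrite -mulgA; apply/nat_leMl/zexpgD.
- case: eqP => [_|_]; first by rewrite -mulgA; apply/nat_leMl/zexpgD.
  by rewrite -mulgA addrAC; apply/nat_leMl/zexpgD.
Qed.

(** [Q x] plays the role of x^-1 p x. If x^-1 does not cancel, j <> 0 keeps the final x from
    cancelling it. *)
Lemma val_end_mul_zexpQ st k j x : j != 0%R ->
  nat_le (val_end st k * zexpg (Q x) j)
         (val_nf (push x true (shift j (push x false (st, k))))).
Proof.
move=> j0; rewrite {2}/push {1}/cancels; case: ifPn => [|_].
  case: st => [|[[k' y] []] st] //=; rewrite ?andbF //.
  rewrite andbT => /andP[/eqP -> /eqP ->]; rewrite mulg1.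
  exact: val_next_zexpQ.
rewrite /shift /push /cancels /= add0r (negPf j0) /= /val_nf /= eqxx mulg1.
exact: nat_le_refl.
Qed.

End NormalForms.

(** * Congruences descending to a quotient *)

Section QuotientCongruence.
Variables (M : monoidType) (r c : M -> M -> Prop).
Hypothesis cc : congruence c.
Hypothesis rc : forall s t, r s t -> c s t.

(** [S_monoid] is a quotient of a quotient of words: a congruence on words first descends to the
    free inverse monoid. *)
Definition quo_cong (p q : quo r) : Prop := c (repr p) (repr q).

Lemma repr_quo_cong s : c (repr (quo_proj r s)) s.
Proof. by apply: (repr_quo (r := r)). Qed.

Lemma quo_congE s t : quo_cong (quo_proj r s) (quo_proj r t) <-> c s t.
Proof.
have [_ cS cT _] := cc; rewrite /quo_cong.
split=> h.
  apply: (cT _ _ _ _ (repr_quo_cong t)).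
  exact: (cT _ _ _ (cS _ _ (repr_quo_cong s)) h).
apply: (cT _ _ _ (repr_quo_cong s)).
exact: (cT _ _ _ h (cS _ _ (repr_quo_cong t))).
Qed.

Lemma quo_cong_congruence : congruence quo_cong.
Proof.
have [c1 cS cT cM] := cc.
split=> [p|p q|p q s|]; [exact: c1|exact: cS|exact: cT|].
elim/quo_ind=> s; elim/quo_ind=> t; elim/quo_ind=> u; elim/quo_ind=> v.
by rewrite -!quo_projM !quo_congE; apply: cM.
Qed.

End QuotientCongruence.

(** * Words representing elements of [S_monoid] *)

Definition wordS (w : iword letter) : S_monoid :=
  quo_proj S_rels (quo_proj (@wagner letter) w).

Lemma wordS_surj (s : S_monoid) : exists w, s = wordS w.
Proof. by elim/quo_ind: s => s; elim/quo_ind: s => w; exists w. Qed.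

Lemma wordS_cat u v : wordS (u ++ v) = wordS u * wordS v.
Proof. by rewrite /wordS -quo_projM -quo_projM. Qed.

Lemma wordS_cons l w : wordS (l :: w) = letter_val S_gen l * wordS w.
Proof.
rewrite -cat1s wordS_cat; congr (_ * _); case: l => x [] //=.
rewrite /letter_val /= /S_gen /inv_gen -quo_projV; congr quo_proj.
by rewrite -FIM_projV.
Qed.

Lemma wordS0 : wordS [::] = 1.
Proof. by []. Qed.

Lemma wordS1 l : wordS [:: l] = letter_val S_gen l.
Proof. by rewrite wordS_cons wordS0 mulg1. Qed.

Lemma wordS_rcons w l : wordS (rcons w l) = wordS w * letter_val S_gen l.
Proof. by rewrite -cats1 wordS_cat wordS1. Qed.

Definition relator_word : iword letter :=
  [:: (Lb, false); (Lc, false); (Lb, true); (La, false); (Ld, true);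
      (La, true); (Lc, true); (Lc, false); (Ld, true); (Ld, false)].

Lemma relator_wordE : quo_proj (@wagner letter) relator_word = relator.
Proof. by rewrite /relator /fim_gen -!FIM_projV -!quo_projM. Qed.

(** * Actions of [S_monoid] by partial bijections *)

Section Action.
Variables (Z : Type) (Y : pred Z).
Variables (xf xb : bool -> Z -> Z) (pf pb : Z -> Z).
Hypotheses (xfK : forall x, cancel (xf x) (xb x))
           (xbK : forall x, cancel (xb x) (xf x)).
Hypotheses (pfK : cancel pf pb) (pbK : cancel pb pf).
Hypothesis Yx : forall x z, Y z -> Y (xf x z).
Hypothesis Yp : forall z, Y z -> Y (pf z).
Hypothesis Yq : forall x z, Y z -> Y (xf x (pb (xb x z))).

(* The free letters true and false are a and b; c and d act as b^-1 p b and
   a^-1 p a. *)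
Definition act_letter (l : letter * bool) : Z -> Z :=
  match l with
  | (La, false) => xf true
  | (La, true) => xb true
  | (Lb, false) => xf false
  | (Lb, true) => xb false
  | (Lc, false) => fun z => xf false (pf (xb false z))
  | (Lc, true) => fun z => xf false (pb (xb false z))
  | (Ld, false) => fun z => xf true (pf (xb true z))
  | (Ld, true) => fun z => xf true (pb (xb true z))
  end.

Definition act (w : iword letter) (z : Z) : Z :=
  foldl (fun z l => act_letter l z) z w.

(* The path labelled w from z visits only points of Y: the partial bijection of
   Y induced by w is defined at z. *)
Fixpoint stays (w : iword letter) (z : Z) : bool :=
  if w is l :: w' then Y z && stays w' (act_letter l z) else Y z.

Lemma act_letterK l : cancel (act_letter l) (act_letter (l.1, ~~ l.2)).
Proof. by case: l => [[] []] z /=; rewrite ?xfK ?pfK ?pbK ?xbK. Qed.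

Arguments act_letter : simpl never.

Lemma act_cat u v z : act (u ++ v) z = act v (act u z).
Proof. exact: foldl_cat. Qed.

Lemma stays_cat u v z : stays (u ++ v) z = stays u z && stays v (act u z).
Proof.
elim: u z => [|l u IH] z /=; last by rewrite IH andbA.
by case: v => [|l v] /=; [rewrite andbb|rewrite andbA andbb].
Qed.

Lemma iword_inv_cons (l : letter * bool) w :
  iword_inv (l :: w) = iword_inv w ++ [:: (l.1, ~~ l.2)].
Proof. by rewrite /iword_inv /= rev_cons -cats1. Qed.

Lemma actK u : cancel (act u) (act (iword_inv u)).
Proof.
elim: u => [|l u IH] z //.
rewrite iword_inv_cons act_cat -[act (l :: u) z]/(act u (act_letter l z)) IH.
exact: act_letterK.
Qed.

Lemma actVK u : cancel (act (iword_inv u)) (act u).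
Proof. by move=> z; have := actK (iword_inv u) z; rewrite iword_invK. Qed.

(** The reversed path visits the same points. *)
Lemma staysV u z : stays (iword_inv u) (act u z) = stays u z.
Proof.
elim: u z => [|l u IH] z //.
rewrite iword_inv_cons stays_cat -[act (l :: u) z]/(act u (act_letter l z)).
rewrite IH actK /= act_letterK (andbC (Y _)) andbC -andbA; congr (_ && _).
by case: u {IH} => [|? ?] /=; rewrite ?andbA andbb.
Qed.

Definition same_action (u v : iword letter) : Prop :=
  forall z, act u z = act v z /\ stays u z = stays v z.

Lemma same_action_congruence : congruence same_action.
Proof.
split=> [s|s t st|s t u st tu|s t u v st uv] z //.
- by have [-> ->] := st z.
- by have [-> ->] := st z; have [-> ->] := tu z.
- rewrite -!/(_ ++ _) !act_cat !stays_cat.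
  by have [-> ->] := st z; have [-> ->] := uv (act t z).
Qed.

Lemma same_action_wagner u v : wagner u v -> same_action u v.
Proof.
case=> {}u => [|{}v] z; rewrite !(act_cat, stays_cat) !actK staysV.
  by rewrite !andbb.
by rewrite ?actK ?staysV ?andbb andbC.
Qed.

(** Every point visited by the relator arises from z by a, b, p, c^-1, d^-1 or products of these,
    under which Y is stable. *)
Lemma same_action_relator : same_action relator_word [::].
Proof.
move=> z; split; first by rewrite /act /act_letter /= !(xfK, xbK, pfK, pbK).
rewrite /= /act_letter /= !(xfK, xbK, pfK, pbK).
apply/idP/idP => [/andP[]//|Yz].
by repeat (apply/andP; split); auto.
Qed.

Lemma same_action_wordS u v : wordS u = wordS v -> same_action u v.
Proof.
have c1 := same_action_congruence.
have c2 := quo_cong_congruence c1 same_action_wagner.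
move=> /quoP h; have {h} := h _ c2; rewrite quo_congE; first last.
- exact: same_action_wagner.
- exact: c1.
apply=> _ _ [-> ->]; rewrite -relator_wordE.
rewrite -[1]/(quo_proj (@wagner letter) [::]).
apply/quo_congE => //; [exact: same_action_wagner|exact: same_action_relator].
Qed.

Lemma same_act_sigma u v :
  sigma (wordS u) = sigma (wordS v) -> act u =1 act v.
Proof.
pose c (s t : S_monoid) := forall u v, s = wordS u -> t = wordS v ->
  act u =1 act v.
have actE u' v' : wordS u' = wordS v' -> act u' =1 act v'.
  by move=> /same_action_wordS h z; case: (h z).
have cc : congruence c.
  split=> [s u' v' -> /actE //|s t h u' v' hs ht z|s t w h1 h2 u' v' hs hw z|].
  - by rewrite (h _ _ ht hs).
  - by have [t' ht] := wordS_surj t; rewrite (h1 _ _ hs ht) (h2 _ _ ht hw).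
  - move=> s t s' t' h1 h2 u' v' hs ht z.
    have [w1 e1] := wordS_surj s; have [w2 e2] := wordS_surj t.
    have [w3 e3] := wordS_surj s'; have [w4 e4] := wordS_surj t'.
    rewrite e1 e3 -wordS_cat in hs; rewrite e2 e4 -wordS_cat in ht.
    rewrite -(actE _ _ hs) -(actE _ _ ht) !act_cat.
    by rewrite (h1 _ _ e1 e2) (h2 _ _ e3 e4).
(* An idempotent bijection is the identity, so [c] identifies all idempotents. *)
have idem w : wordS w * wordS w = wordS w -> forall z, act w z = z.
  rewrite -wordS_cat => /actE h z.
  by apply: (can_inj (actK w)); rewrite -act_cat h.
move=> /quoP h; apply: (h c cc) => // s t [ss tt] u' v' es et z.
by rewrite !idem // -?es -?et.
Qed.

End Action.

(** * One-sided units *)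

Section OneSidedUnits.
Variable M : inverseMonoidType.
Implicit Types s t : M.

Lemma mulg1_rinv s t : s * t = 1 -> s * s^-1 = 1.
Proof. by move=> st; rewrite -[RHS]st -{3}(mulgVg_id s) -!mulgA st mulg1. Qed.

Lemma mulg1_linv s t : s * t = 1 -> t^-1 * t = 1.
Proof. by move=> st; rewrite -[RHS]st -{3}(mulgVg_id t) !mulgA st mul1g. Qed.

Lemma mulg1_inv s t : s * t = 1 -> s = t^-1.
Proof.
by move=> st; apply: invg_unique; [rewrite -mulgA st mulg1|rewrite st mul1g].
Qed.

Lemma Rrelated_rinv s t : t * t^-1 = 1 -> Rrelated s (s * t).
Proof. by move=> t1; rewrite /Rrelated invgM mulgA -(mulgA s) t1 mulg1. Qed.

Lemma expg_rinv s n : s * s^-1 = 1 -> s ^+ n * (s ^+ n)^-1 = 1.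
Proof.
move=> s1; elim: n => [|n IH]; first by rewrite mul1g invg1.
by rewrite expgS invgM mulgA -(mulgA s) IH mulg1.
Qed.

End OneSidedUnits.

(** * One-sided units among the generators of [S_monoid] *)

Definition S_X (x : bool) : S_monoid := S_gen (if x then La else Lb).
Definition S_Q (x : bool) : S_monoid := S_gen (if x then Ld else Lc).
Definition S_p : S_monoid := S_X false * S_Q false * (S_X false)^-1.

Lemma wordS_relator : wordS relator_word = 1.
Proof.
rewrite /wordS relator_wordE; apply/quoP.
exact: (congruence_gen_sub (r := S_rels)).
Qed.

Lemma S_relator :
  S_p * S_X true * (S_Q true)^-1 * (S_X true)^-1 * (S_Q false)^-1 * S_Q false
    * (S_Q true)^-1 * S_Q true = 1.
Proof.
rewrite -wordS_relator /relator_word !wordS_cons wordS0 mulg1 /letter_val /=.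
by rewrite /S_p /S_X /S_Q !mulgA.
Qed.

(** A right factor of 1 is left invertible: this applies to d, and to c once d^-1 d has been
    cancelled. *)
Lemma S_QV x : (S_Q x)^-1 * S_Q x = 1.
Proof.
have r := S_relator; have d1 := mulg1_linv r.
case: x => //; rewrite -mulgA d1 mulg1 in r; exact: mulg1_linv r.
Qed.

Lemma S_relator_short : S_p * (S_X true * S_Q true * (S_X true)^-1)^-1 = 1.
Proof.
have := S_relator; rewrite -!mulgA S_QV mulg1 S_QV mulg1 => r.
by rewrite !invgM invgK !mulgA -r !mulgA.
Qed.

Lemma S_pE x : S_p = S_X x * S_Q x * (S_X x)^-1.
Proof.
by case: x => //; rewrite (mulg1_inv S_relator_short) invgK.
Qed.

Lemma S_pV : S_p * S_p^-1 = 1.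
Proof. exact: mulg1_rinv S_relator_short. Qed.

Lemma S_XV x : S_X x * (S_X x)^-1 = 1.
Proof.
have := S_pV; rewrite {1}(S_pE x) -!mulgA; exact: mulg1_rinv.
Qed.

(** * The group acting on reduced normal forms *)

Fixpoint reduced (st : stack) : bool :=
  if st is (k, x, e) :: st' then reduced st' && ~~ cancels x e (st', k)
  else true.

Lemma push_reduced x e n : reduced n.1 -> reduced (push x e n).1.
Proof.
case: n => st k /= r; rewrite /push; case: ifPn => c /=; last by rewrite r c.
by case: st r {c} => [|[[k' y] e'] st] //= /andP[].
Qed.

(** After a cancellation, reducedness keeps the exposed letter from cancelling the one pushed
    back. *)
Lemma pushK x e n : reduced n.1 -> push x (~~ e) (push x e n) = n.
Proof.
case: n => st k /= r; rewrite {2}/push; case: ifPn => c; last first.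
  by rewrite /push {1}/cancels /= !eqxx negbK eqxx.
case: st r c => [|[[k' y] e'] st] //= /andP[_ nc]; rewrite /cancels /=.
move=> /and3P[/eqP -> /eqP yx /eqP ee]; rewrite yx ee in nc *.
by rewrite /push (negPf nc).
Qed.

Lemma shiftK j : cancel (shift j) (shift (- j)%R).
Proof. by case=> st k; rewrite /shift /= addrK. Qed.

Definition normal_form : Type := {n : stack * int | reduced n.1}.

Definition nf_push (e x : bool) (n : normal_form) : normal_form :=
  exist _ (push x e (sval n)) (push_reduced x e (svalP n)).

Definition nf_shift (j : int) (n : normal_form) : normal_form :=
  exist _ (shift j (sval n)) (svalP n).

Definition nf0 : normal_form := exist (fun n => reduced n.1) ([::], 0%R) isT.

Lemma nf_pushK e x : cancel (nf_push e x) (nf_push (~~ e) x).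
Proof. by move=> n; apply: val_inj; apply: pushK (svalP n). Qed.

Lemma nf_shiftK j : cancel (nf_shift j) (nf_shift (- j)%R).
Proof. by move=> n; apply: val_inj; apply: shiftK. Qed.

Definition nf_act : iword letter -> normal_form -> normal_form :=
  act (nf_push true) (nf_push false) (nf_shift 1%R) (nf_shift (-1)%R).

(** Van der Waerden's method: the normal form of a word depends only on its image in G. No point is
    removed here. *)
Lemma nf_act_sigma u v :
  sigma (wordS u) = sigma (wordS v) -> nf_act u =1 nf_act v.
Proof.
apply: (same_act_sigma (Y := predT)) => //.
- by move=> x; apply: (nf_pushK true).
- by move=> x; apply: (nf_pushK false).
- exact: (nf_shiftK 1%R).
- exact: (nf_shiftK (-1)%R).
Qed.

(** * E-unitarity from upper bounds *)

Definition S_val (N : nat) (n : normal_form) : S_monoid :=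
  val_nf S_X S_Q S_p N (sval n).

Lemma S_val0 N : S_val N nf0 = 1.
Proof. by []. Qed.

Lemma S_val_letter (N : nat) (n : normal_form) l : ((sval n).2 <= Posz N)%R ->
  nat_le (S_val N n * letter_val S_gen l) (S_val N (nf_act [:: l] n)).
Proof.
rewrite /S_val /nf_act; case: n => -[st k] r /= kN.
have posX := val_end_mulX S_XV S_pE S_pV.
have negX := val_end_mulXV S_XV S_pE S_pV N.
have mulQ := val_end_mul_zexpQ S_X S_Q S_p N.
case: l => [[] []]; rewrite /letter_val /=.
- exact: (negX _ _ true).
- exact: (posX _ _ _ true).
- exact: (negX _ _ false).
- exact: (posX _ _ _ false).
- exact: (mulQ _ _ (-1)%R false).
- exact: (mulQ _ _ 1%R false).
- exact: (mulQ _ _ (-1)%R true).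
- exact: (mulQ _ _ 1%R true).
Qed.

Lemma wordS_le_val w :
  exists N0, forall N, N0 <= N -> nat_le (wordS w) (S_val N (nf_act w nf0)).
Proof.
elim/last_ind: w => [|w l [N0 IH]].
  by exists 0%N => N _; rewrite S_val0 wordS0; apply: nat_le_refl.
(* N must also bound the exponent of p just before the last letter. *)
exists (maxn N0 `|(val (nf_act w nf0)).2|%N) => N.
rewrite geq_max => /andP[N0N kN].
rewrite wordS_rcons; apply: nat_le_trans (nat_leMr _ (IH _ N0N)) _.
rewrite -cats1 [nf_act (_ ++ _) _]act_cat; apply: S_val_letter.
by apply: le_trans (ler_norm _) _; rewrite -abszE lez_nat.
Qed.

Lemma sigma_inj_Rrelated (s t : S_monoid) :
  Rrelated s t -> sigma s = sigma t -> s = t.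
Proof.
have [u ->] := wordS_surj s; have [v ->] := wordS_surj t.
move=> st /nf_act_sigma uv.
have [Nu le_u] := wordS_le_val u; have [Nv le_v] := wordS_le_val v.
(* For a common N both elements lie below one m, so s = s s^-1 m = t t^-1 m = t. *)
have := le_u _ (leq_maxl Nu Nv); have := le_v _ (leq_maxr Nu Nv).
by rewrite uv => /nat_leE hv /nat_leE hu; rewrite hu st -hv.
Qed.

Lemma S_E_unitary : E_unitary S_monoid.
Proof.
move=> _ [s ->] t u; rewrite !inE => st su; apply: sigma_inj_Rrelated.
by rewrite /Rrelated -st.
Qed.

(** * The map to G, paths and word metrics *)

Lemma sigmaM (S : inverseMonoidType) (s t : S) :
  sigma (s * t) = sigma s * sigma t.
Proof. exact: quo_projM. Qed.

Lemma sigmaV (S : inverseMonoidType) (s : S) : sigma s^-1 = (sigma s)^-1.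
Proof. exact: quo_projV. Qed.

Lemma sigma_letter_val (S : inverseMonoidType) (X : Type) (gen : X -> S) l :
  sigma (letter_val gen l) = letter_val (@sigma S \o gen) l.
Proof. by case: l => x [] //; apply: sigmaV. Qed.

Section PathWords.
Variables (X : Type) (M : starMonoidType) (gen : X -> M).

Definition word_val (w : iword X) : M :=
  foldr (fun l s => letter_val gen l * s) 1 w.

Lemma cayley_path_word_val V s w t :
  cayley_path gen V s w t -> t = s * word_val w.
Proof.
elim: w s => [|l w IH] s /=; first by case=> _ ->; rewrite mulg1.
by case=> _ [_ -> /IH ->]; rewrite mulgA.
Qed.

Lemma cayley_pathP (V : set M) s w t : (forall u, V u) ->
  cayley_path gen V s w t <-> t = s * word_val w.
Proof.
move=> VT; split; first exact: cayley_path_word_val.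
elim: w s => [|l w IH] s /= e; first by rewrite e mulg1.
by split=> //; exists (s * letter_val gen l) => //; apply: IH; rewrite -mulgA.
Qed.

End PathWords.

Lemma wordS_word_val w : wordS w = word_val S_gen w.
Proof. by elim: w => [|l w IH] //=; rewrite wordS_cons IH. Qed.

Lemma word_dist_mull (R : realType) (X : Type) (G : groupType) (gen : X -> G)
  (h s t : G) : word_dist R gen (h * s) (h * t) = word_dist R gen s t.
Proof.
have rel (u v : G) : Rrelated u v by rewrite /Rrelated !mulgV.
rewrite /word_dist !asboolT //; congr ereal_inf; congr image.
apply/funext => w; apply/propext.
rewrite /= !cayley_pathP; try by move=> u; apply: rel.
by split=> [|->]; rewrite -mulgA => // /mulgI.
Qed.

(** * An action that bounds path lengths in [S_monoid] from below *)

(* A point [(i, l)]: the free group on two letters (the booleans) and p acts on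
   copies of the line p^Z indexed by levels; level [Below 0] carries the shift
   by p, and the letter x moves it to [Above x 0]. *)
Inductive level := Below of nat | Above of bool & nat.

Definition raise (x : bool) (z : int * level) : int * level :=
  match z with
  | (i, Below 0) => (i, Above x 0)
  | (i, Below n.+1) => (i, Below n)
  | (i, Above y n) => (i, Above y (if y == x then n.+1 else n))
  end.

Definition lower (x : bool) (z : int * level) : int * level :=
  match z with
  | (i, Below n) => (i, Below n.+1)
  | (i, Above y 0) => (i, if y == x then Below 0 else Above y 0)
  | (i, Above y n.+1) => (i, Above y (if y == x then n else n.+1))
  end.

Definition slide (j : int) (z : int * level) : int * level :=
  if z is (i, Below 0) then ((i + j)%R, Below 0) else z.

(* Every level [Below n] is cut, not only [Below 0]: otherwise a or b would lead
   from outside the cut into it. *)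
Definition uncut (N : nat) (z : int * level) : bool :=
  if z is (i, Below _) then (- Posz N < i)%R else true.

Lemma raiseK x : cancel (raise x) (lower x).
Proof.
move=> [i [[|n]|y n]] //=; first by rewrite eqxx.
by case: (y == x) => //; case: n.
Qed.

Lemma lowerK x : cancel (lower x) (raise x).
Proof.
move=> [i [n|y [|n]]] //=; case: (eqVneq y x) => [->|/negPf yx] //=.
all: by rewrite ?eqxx ?yx.
Qed.

Lemma slideK j : cancel (slide j) (slide (- j)%R).
Proof. by move=> [i [[|n]|y n]] //=; rewrite addrK. Qed.

Definition level_act : iword letter -> int * level -> int * level :=
  act raise lower (slide 1%R) (slide (-1)%R).

Definition level_stays (N : nat) : iword letter -> int * level -> bool :=
  stays (uncut N) raise lower (slide 1%R) (slide (-1)%R).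

Lemma level_same_action N u v z : wordS u = wordS v ->
  level_act u z = level_act v z /\ level_stays N u z = level_stays N v z.
Proof.
move=> uv; apply: same_action_wordS uv z.
- exact: raiseK.
- exact: lowerK.
- exact: (slideK 1%R).
- exact: (slideK (-1)%R).
- by move=> x [i [[|n]|y n]].
- move=> [i [[|n]|y n]] //=; lia.
(* The step back along p happens at [Below 0], but x then leads to [Above x 0], which is never
   cut. *)
- move=> x [i [[|n]|y [|n]]] //=; first by case: eqP.
Qed.

(** A path visits finitely many points, each uncut for large N. *)
Lemma level_stays_large w z :
  exists N0, forall N, N0 <= N -> level_stays N w z.
Proof.
have large z' : exists N0, forall N, N0 <= N -> uncut N z'.
  exists `|z'.1|.+1 => N; case: z' => i [n|//] /=; lia.
rewrite /level_stays; elim: w z => [|l w IH] z /=; first exact: large.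
have [N1 h1] := large z.
have [N2 h2] := IH (act_letter raise lower (slide 1%R) (slide (-1)%R) l z).
exists (maxn N1 N2) => N; rewrite geq_max => /andP[/h1 -> /h2 ->].
by [].
Qed.

Lemma level_stays_uncut N w z : level_stays N w z -> uncut N z.
Proof. by case: w => [|l w] //= /andP[]. Qed.

(** The path leaves the levels [Above false] through an uncut [Below] point, and each letter raises
    i by at most one. *)
Lemma crossing_length N w i m i' m' :
  level_stays N w (i, Above false m) ->
  level_act w (i, Above false m) = (i', Above true m') ->
  (- i <= Posz (size w + N))%R.
Proof.
elim: w i m => [|l w IH] i m; first by move=> _ [].
have below j n : (j <= i + 1)%R ->
    level_stays N w (j, Below n) -> (- i <= Posz (size (l :: w) + N))%R.
  by move=> ji /level_stays_uncut /=; lia.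
have above j n : (j <= i + 1)%R -> level_stays N w (j, Above false n) ->
    level_act w (j, Above false n) = (i', Above true m') ->
    (- i <= Posz (size (l :: w) + N))%R.
  by move=> ji h1 h2; have := IH _ _ h1 h2; rewrite /=; lia.
have ii : (i <= i + 1)%R by lia.
have im : (i - 1 <= i + 1)%R by lia.
rewrite [level_stays _ _ _]/= [level_act _ _]/=.
rewrite -/(level_stays N _) -/(level_act w _).
case: l IH below above => [[] []] _ below above; rewrite /act_letter.
all: case: m => [|m].
all: try exact: above.
all: by move=> /below h _; apply: h.
Qed.

(** * R-related elements that drift apart in [S_monoid] but not in G *)

Definition descent (x : bool) (n : nat) : iword letter :=
  (if x then La else Lb, false) :: nseq n (if x then Ld else Lc, true).

(** [N.+1] makes the starting point uncut, as [uncut] is strict; the later points lie on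
    [Above x 0]. *)
Lemma level_descent N x n :
  level_stays N.+1 (descent x n) (0%R, Below 0) /\
  level_act (descent x n) (0%R, Below 0) = ((- Posz n)%R, Above x 0).
Proof.
pose w := nseq n (if x then Ld else Lc, true).
have step i : level_stays N.+1 w (i, Above x 0) /\
    level_act w (i, Above x 0) = ((i - Posz n)%R, Above x 0).
  rewrite /w {w}; elim: n i => [|n IH] i; first by split; rewrite ?subr0.
  have [h1 h2] := IH (i - 1)%R.
  have -> : (i - Posz n.+1 = i - 1 - Posz n)%R by lia.
  by case: x {IH} h1 h2.
by have := step 0%R; rewrite sub0r; case: x @w {step} => w -[h1 h2]; split.
Qed.

Lemma wordS_descent x n :
  wordS (descent x n) = S_X x * zexpg (S_Q x) (- Posz n)%R.
Proof.
rewrite /descent wordS_cons zexpg_opp /=; congr (_ * _).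
elim: n => [|n IH] //; rewrite [nseq _ _]/= wordS_cons IH expgS.
by case: x {IH}.
Qed.

Lemma sigma_descent x n :
  sigma (wordS (descent x n)) =
  sigma (zexpg S_p (- Posz n)%R) * sigma (S_X x).
Proof.
rewrite wordS_descent -(mul_X_zexpQ_XV S_XV S_pE S_pV x).
by rewrite [in RHS]sigmaM sigmaV mulgVK.
Qed.

Lemma descent_rinv x n : wordS (descent x n) * (wordS (descent x n))^-1 = 1.
Proof.
have Qn : (S_Q x)^-1 ^+ n * ((S_Q x)^-1 ^+ n)^-1 = 1.
  by apply: expg_rinv; rewrite invgK S_QV.
by rewrite wordS_descent zexpg_opp /= -(Rrelated_rinv (S_X x) Qn) S_XV.
Qed.

Lemma descent_distance (s : S_monoid) :
  exists N, forall n w,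
    s * wordS (descent true n) = s * wordS (descent false n) * wordS w ->
    n <= size w + N.
Proof.
have [v ->] := wordS_surj s.
(* Reading v from z ends at the start of the descents. *)
pose z := level_act (iword_inv v) (0%R, Below 0).
have [N0 stay] := level_stays_large v z.
exists N0.+1 => n w; rewrite -!wordS_cat => e.
have [] := level_same_action N0.+1 z e.
have vz : level_act v z = (0%R, Below 0).
  by apply: actVK; [exact: raiseK|exact: lowerK|exact: (slideK 1%R)
                   |exact: (slideK (-1)%R)].
(* The left-hand path stays uncut, hence so does w, leading from (-n, [Above false 0]) to (-n,
   [Above true 0]). *)
rewrite /level_act /level_stays !act_cat !stays_cat !act_cat.
rewrite -!/(level_act _ _) -!/(level_stays _ _ _) vz stay //.
have [-> ->] := level_descent N0 true n.
have [-> ->] := level_descent N0 false n.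
by move=> /esym a /esym b; have := crossing_length b a; lia.
Qed.

Lemma S_unbounded_distortion (R : realType) (C : set S_monoid) :
  is_Rclass C -> ~ bounded_distortion_on R S_gen C.
Proof.
move=> [s ->] [phi [_ bound]].
have [N long] := descent_distance s.
have in_C x n : Rclass s (s * wordS (descent x n)).
  exact/Rrelated_rinv/descent_rinv.
pose dG := word_dist R (@sigma S_monoid \o S_gen).
pose D := dG (sigma (S_X false)) (sigma (S_X true)).
have distG n : dG (sigma (s * wordS (descent false n)))
    (sigma (s * wordS (descent true n))) = D.
  (* The common left factor s p^-n drops out by left invariance. *)
  by rewrite /dG !sigmaM !sigma_descent !mulgA word_dist_mull.
(* m exceeds the constant bound given by phi, while the descents of length m + N are at distance at
   least m. *)
have phi_m := truncnS_gt (phi (fine D)); set m := _.+1 in phi_m.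
have := bound _ _ (in_C false (m + N)%N) (in_C true (m + N)%N).
rewrite -/dG distG leNgt => /negP; apply.
apply: (@lt_le_trans _ _ m%:R%:E); first by rewrite lte_fin.
rewrite /word_dist; case: asboolP => _; last exact: leey.
apply/ereal_infP => _ [w /= path_w <-].
rewrite lee_fin ler_nat -(leq_add2r N); apply: long.
by rewrite (wordS_word_val w); apply: cayley_path_word_val path_w.
Qed.

Theorem theorem4p6 (R : realType) :
  E_unitary S_monoid /\
  ~ locally_bounded_group_distortion R S_gen /\
  (forall C : set S_monoid, is_Rclass C ->
     schutzenberger_embeds S_gen C /\ ~ bounded_distortion_on R S_gen C).
Proof.
split; first exact: S_E_unitary.
split=> [lb|C RC].
  have R1 : is_Rclass (Rclass (1 : S_monoid)) by exists 1.
  exact: S_unbounded_distortion R1 (lb _ R1).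
split; last exact: S_unbounded_distortion.
split; first exact: S_E_unitary.
by move=> s t l _ _ ->; rewrite /cayley_edge sigmaM sigma_letter_val.
Qed.
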